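(* Let $\lambda$ be a successor cardinal (i.e. $\lambda=\nu^+$ for some infinite cardinal $\nu$). Then there exists a $\lambda$-bounded $C$-sequence $\vec C=\langle C_\delta\mid \delta\in E^{\lambda^+}_\lambda\rangle$ such that for every club $D\subseteq\lambda^+$ there is $\delta\in E^{\lambda^+}_\lambda$ for which the set $$\{\beta<\delta\mid \min(C_\delta\setminus(\beta+1))\in D\cap E^{\lambda^+}_\lambda\}$$ is stationary in $\delta$.
   Context: For a regular cardinal $\kappa$ and infinite regular $\mu<\kappa$, $E^\kappa_\mu=\{\alpha<\kappa\mid \mathrm{cf}(\alpha)=\mu\}$. A $C$-sequence over a set $S$ of limit ordinals is a sequence $\langle C_\delta\mid\delta\in S\rangle$ such that each $C_\delta$ is a closed subset of $\delta$ (closed in the order topology of $\delta$) with $\sup(C_\delta)=\delta$. It is $\xi$-bounded if $\mathrm{otp}(C_\delta)\le\xi$ for all $\delta\in S$. *)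

(* Defs.v *)
(* MathComp-Analysis *)
From HB Require Import structures.
From mathcomp Require Import all_boot all_order.
From mathcomp Require Import all_classical.
From mathcomp Require Import wochoice topology.

Set Implicit Arguments.
Unset Strict Implicit.
Unset Printing Implicit Defensive.

Import Order.TTheory.

Local Open Scope order_scope.
Local Open Scope classical_set_scope.
Local Open Scope card_scope.

(* Ordinals are the elements of a well-ordered type W carrying its order
   topology; a : W stands for the order type of [set x | x < a], the set of its
   predecessors (a itself, in von Neumann's representation).  W is thus the
   set of all ordinals below some bound.  All the notions below concern only
   ordinals and sets of ordinals below their arguments, so they do not depend
   on the choice of W. *)
Section ordinals.
Context {d : Order.disp_t} {W : orderTopologicalType d}.
Implicit Types (a b m nu lam kap delta xi : W) (A D S : set W) (C : W -> set W).

Definition is_wo (T : orderTopologicalType d) : Prop :=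
  well_order (<=%O : rel T).

Definition below a : set W := [set x | x < a].

Definition upto a : set W := [set x | x <= a].  (* the ordinal a + 1 *)

Definition least A a : Prop := A a /\ lbound A a.

Definition limit_ordinal a : Prop :=
  (exists x, x < a) /\ (forall x, x < a -> exists2 y, x < y & y < a).

(* cardinals are initial ordinals *)
Definition cardinal_ordinal a : Prop :=
  forall b, b < a -> ~ (below a #<= below b).

Definition infinite_cardinal a : Prop :=
  cardinal_ordinal a /\ infinite_set (below a).

(* lam = nu^+ *)
Definition successor_cardinal nu lam : Prop :=
  least [set m | cardinal_ordinal m /\ nu < m] lam.

(* otp(A) = a *)
Definition has_otp A a : Prop :=
  exists f : W -> W, f @` A = below a /\ {in A &, {mono f : x y / x < y}}.

Definition otp_le A xi : Prop := exists2 a, a <= xi & has_otp A a.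

Definition cofinal_in a A : Prop :=
  A `<=` below a /\ (forall x, x < a -> exists2 y, A y & x <= y).

(* cf(a) = m *)
Definition has_cf a m : Prop :=
  least [set n | exists2 A, cofinal_in a A & has_otp A n] m.

(* E^kap_m *)
Definition cof_set kap m : set W := [set a | a < kap /\ has_cf a m].

(* As [below a] is an initial segment of W, the subspace topology on it is
   the order topology of a. *)
Definition closed_in a A : Prop :=
  A `<=` below a /\ closed (A : set (subspace (below a))).

Definition club a A : Prop := closed_in a A /\ supremums A a.

Definition stationary a S : Prop :=
  S `<=` below a /\ (forall D, club a D -> S `&` D !=set0).

(* Only the values of C on S are relevant. *)
Definition C_sequence S C : Prop :=
  S `<=` limit_ordinal /\
  (forall delta, S delta -> closed_in delta (C delta) /\ supremums (C delta) delta).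

Definition bounded_seq xi S C : Prop :=
  forall delta, S delta -> otp_le (C delta) xi.

End ordinals.

Arguments is_wo {d} T.

(* Main.v *)
(* Write E for the set of ordinals below kap = lam^+ of cofinality lam = nu^+.

   Fix ladders C_z, z in E, of order type lam without points in E.  They can be
   chosen so that for every club D there is z such that D and E have a common
   point between b and its successor in C_z, for stationarily many b < z
   (lemma nonempty_gaps).  It remains to insert such points into the gaps.

   Given a club D, descend from the upper end g of a gap: replace g by
   sup (D `&` (g + 1)); if the result v is in E, insert it, else cf(v) <= nu and
   we step to a point of a fixed cofinal sequence in v of length nu, and repeat.
   A finite sequence of indices below nu tells which points to take, and each
   such sequence turns the ladders into a candidate C-sequence; there are only
   nu many.  If all of them fail for every D, iterate to get clubs D_0, D_1, ...
   such that D_(n+1) is missed by all the candidates built from D_n.  Choose z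
   for the intersection of the D_n, and then a b that is good for it and bad for
   all the candidates: the latter is possible since cf(z) = lam > nu.  As the sups
   of D_n decrease with n they stabilize, so some descent ends after finitely
   many steps, for almost all n, at the same v in E and in all D_n: v is a correct
   guess. *)
Require Import Defs.
From mathcomp Require Import all_boot all_order.
From mathcomp Require Import all_classical.
From mathcomp Require Import topology.
From mathcomp Require Import interval.

Set Implicit Arguments.
Unset Strict Implicit.
Unset Printing Implicit Defensive.

Import Order.TTheory.

Local Open Scope order_scope.
Local Open Scope classical_set_scope.
Local Open Scope card_scope.

(** * Well-orders and cardinal arithmetic *)

(** By functional extensionality every [F] respects pointwise equality, which is what [Fix_eq] asks
    for. *)
Lemma wf_rec {T U : Type} (R : T -> T -> Prop) (F : forall x, (forall y, R y x -> U) -> U) :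
  well_founded R -> exists f : T -> U, forall x, f x = F x (fun y _ => f y).
Proof.
move=> wfR; exists (Fix wfR (fun=> U) F) => x; rewrite Fix_eq// => y f g fg.
congr (F y _); apply: functional_extensionality_dep => z.
exact: functional_extensionality_dep.
Qed.

Lemma card_surj {T U : Type} (t0 : T) (S : set T) (B : set U) :
  S #<= B -> exists f : U -> T, S `<=` f @` B.
Proof.
move=> /ocard_geP[g]; exists (fun u => odflt t0 (g u)) => t St.
have : some @` S `<=` g @` B := 'surj_g.
by move=> /(_ (Some t))[|u Bu gu]; [exists t|exists u => //; rewrite gu].
Qed.

Lemma surj_card {T U : Type} (f : U -> T) (S : set T) (B : set U) :
  S `<=` f @` B -> S #<= B.
Proof. by move=> /subset_card_le/card_le_trans; apply; apply: card_image_le. Qed.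

(** Hilbert's hotel: along an injective sequence [g] in [S], send [g 0] to the new point [t] and
    each [g n.+1] to [g n], and fix everything else. *)
Lemma card_infinite_add1 {T : Type} (S : set T) (t : T) :
  infinite_set S -> S `|` [set t] #<= S.
Proof.
move=> /infiniteP; elim/Ppointed: T => T in S t *; first by case: (no t).
have [St|nSt] := pselect (S t).
  by move=> _; apply: subset_card_le => x [//|->].
move=> /pcard_leP[g].
have Sg n : S (g n) by exact: funS.
have g_inj m n : g m = g n -> m = n.
  by apply: inj; rewrite in_setT.
apply: (@surj_card _ _ (fun y => if pselect (exists n, y = g n) is left e
  then (if projT1 (cid e) is n.+1 then g n else t) else y)) => x [Sx|->].
- have [[n xn]|nx] := pselect (exists n, x = g n).
    exists (g n.+1) => //; case: pselect => [e|]; last by case; exists n.+1.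
    by case: cid => m /= /g_inj <-.
  by exists x => //; case: pselect.
- exists (g 0%N) => //; case: pselect => [e|]; last by case; exists 0%N.
  by case: cid => m /= /g_inj <-.
Qed.

Section WellOrder.
Context {d : Order.disp_t} {W : orderTopologicalType d} (wo : is_wo W).
Implicit Types (x y z a b : W) (A B C D S : set W).

Lemma ex_least A : A !=set0 -> exists m, least A m.
Proof.
move=> [x Ax]; have [|m [[mA mm] _]] := wo (A := [pred y | y \in A]).
  by exists x; apply/mem_set.
by exists m; split; [exact: set_mem|move=> y Ay; apply/mm/mem_set].
Qed.

Lemma wo_ind (P : W -> Prop) :
  (forall x, (forall y, y < x -> P y) -> P x) -> forall x, P x.
Proof.
move=> IH x; apply: contrapT => nPx.
have [|m [nPm lm]] := @ex_least [set y | ~ P y]; first by exists x.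
apply: nPm; apply: IH => y ym; apply: contrapT => nPy.
by have := lm _ nPy; rewrite leNgt ym.
Qed.

Lemma wf_lt : well_founded (fun x y : W => x < y).
Proof. by move=> x; elim/wo_ind: x => x IH; constructor. Qed.

Lemma least_uniq A x y : least A x -> least A y -> x = y.
Proof. by move=> [Ax lx] [Ay ly]; apply/le_anti; rewrite lx// ly. Qed.

(** The Mostowski collapse: [f x] is the least ordinal above all [f y] with [y] in [A] below [x]. By
    induction [x] itself is such a bound, so the recursion never leaves [W]. *)
Lemma ex_collapse A : exists f : W -> W,
  [/\ forall x, A x -> f x <= x,
      forall x y, A x -> A y -> x < y -> f x < f y &
      forall x z, A x -> z < f x -> exists2 y, A y & f y = z].
Proof.
have [f fE] := @wf_rec W W _ (fun x rec => xget x (least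
  [set z | forall y (h : y < x), A y -> rec y h < z])) wf_lt.
have f_le x : A x -> least [set z | forall y, y < x -> A y -> f y < z] (f x) /\ f x <= x.
  elim/wo_ind: x => x IH Ax.
  have ubx : [set z | forall y, y < x -> A y -> f y < z] x.
    by move=> y yx Ay; have [_] := IH _ yx Ay; move=> h; exact: le_lt_trans h yx.
  suff l : least [set z | forall y, y < x -> A y -> f y < z] (f x).
    by split=> //; apply: l.2.
  rewrite fE; apply: xgetPex; apply: ex_least; by exists x.
exists f; split.
- by move=> x /f_le[].
- by move=> x y Ax /f_le[[+ _] _] xy; apply.
- move=> x z Ax zfx; apply: contrapT => nz.
  (* If [z] is no value, it strictly bounds the values before the first [m] with [z < f m], against
     the leastness of [f m]. *)
  have [|m [[Am zfm] lm]] := @ex_least [set y | A y /\ z < f y]; first by exists x.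
  suff : f m <= z by rewrite leNgt zfm.
  apply: (f_le _ Am).1.2 => y ym Ay.
  rewrite lt_neqAle; apply/andP; split; first by apply/eqP => e; apply: nz; exists y.
  by rewrite leNgt; apply/negP => zfy; have := lm y (conj Ay zfy); rewrite leNgt ym.
Qed.

(** Each point in turn takes the least ordinal not taken by its [R]-predecessors. The third
    hypothesis quantifies over all [f] because it is applied to the recursive assignment itself. *)
Lemma greedy_injection {T : Type} (R : T -> T -> Prop) (D : set T) a :
  well_founded R ->
  (forall p q, D p -> D q -> p <> q -> R p q \/ R q p) ->
  (forall p (f : T -> W), D p -> exists2 x, x < a & forall q, D q -> R q p -> f q <> x) ->
  D #<= below a.
Proof.
move=> wfR totR free.
have [r rE] := @wf_rec T W R (fun p rec => xget a (least
  [set z | forall q, D q -> forall h : R q p, rec q h <> z])) wfR.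
have r_least p : D p -> least [set z | forall q, D q -> R q p -> r q <> z] (r p) /\ r p < a.
  move=> Dp; have [x xa xfree] := free p r Dp.
  suff l : least [set z | forall q, D q -> R q p -> r q <> z] (r p).
    by split=> //; apply: le_lt_trans xa; apply: l.2.
  by rewrite rE; apply: xgetPex; apply: ex_least; exists x.
have rinj : {in D &, injective r}.
  move=> p q /set_mem Dp /set_mem Dq rpq; apply: contrapT => pq.
  have [Rpq|Rqp] := totR _ _ Dp Dq pq.
    by have [[+ _] _] := r_least q Dq => /(_ p Dp Rpq); apply.
  by have [[+ _] _] := r_least p Dp => /(_ q Dq Rqp); apply.
have /card_eqPle[_ h] := inj_card_eq rinj.
apply: card_le_trans h _; apply: subset_card_le => _ [p Dp <-].
by have [_] := r_least p Dp.
Qed.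

Definition godel_lt (q p : W * W) : Prop :=
  Order.max q.1 q.2 < Order.max p.1 p.2 \/
  Order.max q.1 q.2 = Order.max p.1 p.2 /\
    (q.1 < p.1 \/ q.1 = p.1 /\ q.2 < p.2).

Lemma wf_godel_lt : well_founded godel_lt.
Proof.
suff H m x y : Order.max x y = m -> Acc godel_lt (x, y).
  by move=> [x y]; exact: H.
elim/wo_ind: m x y => m IHm x; elim/wo_ind: x => x IHx y.
elim/wo_ind: y => y IHy exy; constructor => -[x' y'] [|[]]/=.
  by rewrite exy => /IHm; apply.
by rewrite exy => e [x'x|[x'x y'y]]; [exact: IHx|subst x'; exact: IHy].
Qed.

Lemma ex_cardinal x : exists c, [/\ c <= x, cardinal_ordinal c & below x #<= below c].
Proof.
have [|c [xc lc]] := @ex_least [set y | below x #<= below y]; first by exists x => /=.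
exists c; split => //; first by apply: lc => /=.
move=> b bc h; have : c <= b by apply: lc; exact: card_le_trans h.
by rewrite leNgt bc.
Qed.

(* Hessenberg: along the Goedel ordering of pairs every proper initial segment
   of a * a lies in some m * m with m < a. *)
Lemma card_squared a : infinite_cardinal a -> below a `*` below a #<= below a.
Proof.
elim/wo_ind: a => a IH [card_a inf_a].
apply: (greedy_injection wf_godel_lt).
- move=> [p1 p2] [q1 q2] _ _ pq; rewrite /godel_lt /=.
  case: (ltgtP (Order.max p1 p2) (Order.max q1 q2)); [by left; left|by right; left|] => e.
  case: (ltgtP p1 q1) => e1; [by left; right; split => //; left| |].
    by right; right; split => //; left.
  case: (ltgtP p2 q2) => e2; [by left; right; split => //; right| |].
    by right; right; split => //; right.
  by case: pq; rewrite e1 e2.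
- move=> [p1 p2] f [/= p1a p2a]; apply: contrapT => nfree.
  pose m := Order.max p1 p2; have ma : m < a by rewrite /m gt_max; apply/andP.
  (* If no value below [a] were free, the predecessors of the pair, all inside the square of
     [m + 1], would be mapped onto [a]. *)
  have sub : below a `<=` f @` (upto m `*` upto m).
    move=> x xa; apply: contrapT => nx; apply: nfree; exists x => // -[q1 q2] _ Rq fq.
    apply: nx; exists (q1, q2) => //.
    have : Order.max q1 q2 <= m by case: Rq => /= [/ltW //|[->]].
    by rewrite ge_max => /andP[].
  have upE : upto m = below m `|` [set m].
    apply/seteqP; split => x /=; first by rewrite /upto /= le_eqVlt => /orP[/eqP|]; [right|left].
    by case=> [/ltW //|->]; rewrite /upto /=.
  have [fin_m|inf_m] := pselect (finite_set (below m)).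
    apply: inf_a; apply: sub_finite_set sub _; apply: finite_image.
    have fu : finite_set (upto m) by rewrite upE finite_setU; split => //; exact: finite_set1.
    exact: finite_setX.
  (* The cardinality [c] of [m] is below [a]. By induction the square of [m + 1] has at most [c]
     elements, so [a] would not be a cardinal. *)
  have [c [cm card_c mc]] := ex_cardinal m.
  have ca : c < a by exact: le_lt_trans ma.
  have inf_c : infinite_set (below c).
    by move=> fc; apply: inf_m; apply: card_le_finite mc fc.
  have um : upto m #<= below c.
    by rewrite upE; apply: card_le_trans mc; apply: card_infinite_add1.
  have [s sE] := card_surj m um.
  apply: (card_a _ ca); apply: card_le_trans (IH _ ca (conj card_c inf_c)).
  apply: (@surj_card _ _ (fun q => f (s q.1, s q.2))) => x /sub[[q1 q2] [/= /sE[i ic <-] /sE[j jc <-]] <-].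
  by exists (i, j).
Qed.

(** Enumerations of [I] and of every [F i] by [a] combine into one by pairs, and [card_squared]
    reduces the pairs to [a]. *)
Lemma card_bigcup {T U : Type} a (I : set U) (F : U -> set T) : infinite_cardinal a ->
  I #<= below a -> (forall i, I i -> F i #<= below a) -> \bigcup_(i in I) F i #<= below a.
Proof.
move=> inf_a cI cF.
have [->|/set0P[t [u Iu Ft]]] := eqVneq (\bigcup_(i in I) F i) set0; first exact: card_ge0.
have [s sE] := card_surj u cI.
have /choice[g gE] : forall i, exists f : W -> T, I i -> F i `<=` f @` below a.
  move=> i; have [Ii|nI] := pselect (I i); last by exists (fun=> t).
  by have [f fE] := card_surj t (cF _ Ii); exists f.
apply: card_le_trans (card_squared inf_a).
apply: (@surj_card _ _ (fun q => g (s q.1) q.2)) => x [i Ii Fx].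
have [k ka sk] := sE _ Ii; have [l la gl] := gE _ Ii _ Fx.
by exists (k, l) => //=; rewrite sk.
Qed.

Lemma card_nat_le a : infinite_cardinal a -> [set: nat] #<= below a.
Proof. by move=> [_ /infiniteP]. Qed.

Lemma card_setU {T : Type} a (A B : set T) : infinite_cardinal a ->
  A #<= below a -> B #<= below a -> A `|` B #<= below a.
Proof.
move=> inf_a cA cB.
apply: card_le_trans (card_bigcup (F := fun n : nat => if n is 0%N then A else B)
  inf_a (card_nat_le inf_a) _); last by case.
by apply: subset_card_le => x [?|?]; [exists 0%N|exists 1%N].
Qed.

End WellOrder.

(** * Closed sets in the order topology *)

Section Topology.
Context {d : Order.disp_t} {W : orderTopologicalType d} (wo : is_wo W).
Implicit Types (x y z a b : W) (A B C D S : set W).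

(** The first clause excludes the least ordinal, for which the second holds vacuously. *)
Definition left_limit A x : Prop :=
  (exists y, y < x) /\ forall y, y < x -> exists2 z, A z & y < z < x.

Lemma left_limit_sub A B x : A `<=` B -> left_limit A x -> left_limit B x.
Proof. by move=> AB [x0 lA]; split => // y /lA[z /AB]; exists z. Qed.

(** In a well-order the sets []y, x + 1[] are neighbourhoods of [x], so points of [A] can accumulate
    at [x] only from the left. *)
Lemma closed_inP a A : closed_in a A <->
  A `<=` below a /\ forall x, x < a -> left_limit A x -> A x.
Proof.
split=> [[sA /closed_subspaceP[V cV VA]]|[sA lA]].
  split=> // x xa [[y0 y0x] lx].
  suff [] : (A `&` below a) x by [].
  rewrite -VA; split => //.
  apply: cV => U; rewrite itv_nbhsE => -[[l r] /= [oi xi] iU].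
  (* Whatever its end points, the neighbourhood contains all points between some [l0] and [x]; [y0]
     serves as [l0] when it is unbounded on the left. *)
  have [l0 [l0x inl]] : exists l0, l0 < x /\ forall z, l0 < z -> z < x -> z \in Interval l r.
    clear iU; move: xi; rewrite itv_boundlr => /andP[l_x xr].
    have rz z : z < x -> (BRight z <= r)%O.
      by move=> zx; apply: le_trans xr; rewrite bnd_simp; exact: ltW.
    case: l oi l_x => [b l|[|]] oi l_x.
    - move: (itv_open_ends_lside oi) => bE; subst b.
      exists l; split => [|z lz zx]; first by move: l_x; rewrite bnd_simp.
      by rewrite itv_boundlr rz// andbT bnd_simp.
    - by exists y0; split => // z _ zx; rewrite itv_boundlr rz.
    - by case: oi l_x.
  have [z Az /andP[l0z zx]] := lx _ l0x.
  exists z; split; last by apply: iU; exact: inl.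
  suff [] : (V `&` below a) z by [].
  by rewrite VA; split => //; exact: sA.
split=> //; apply/closed_subspaceP; exists (closure A); first exact: closed_closure.
apply/seteqP; split => x [Ax xa]; split => //; last exact: subset_closure.
apply: contrapT => nAx.
(* [x'] is the successor of [x]; it exists because [x < a]. *)
have [|x' [xx' lx']] := @ex_least _ _ wo [set y | x < y]; first by exists a.
have near_x y z : A z -> z < x' -> z < x.
  move=> Az zx'; rewrite lt_neqAle; apply/andP; split; first by apply/eqP => e; subst z.
  by rewrite leNgt; apply/negP => /lx'; rewrite leNgt zx'.
have [[y0 y0x]|x0] := pselect (exists y, y < x); last first.
  have [|z [Az /=]] := Ax `]-oo, x'[%classic.
    by apply: open_nbhs_nbhs; split; [exact: lray_open|rewrite /= in_itv].
  by rewrite in_itv /= => zx'; apply: x0; exists z; exact: near_x.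
apply: nAx; apply: lA => //; split; first by exists y0.
move=> y yx.
have [|z [Az /=]] := Ax `]y, x'[%classic.
  by apply: open_nbhs_nbhs; split; [exact: itv_open|rewrite /= in_itv /= yx].
by rewrite in_itv /= => /andP[yz zx']; exists z => //; rewrite yz near_x.
Qed.

Lemma supremums_unbounded a A : A `<=` below a ->
  supremums A a <-> forall x, x < a -> exists2 y, A y & x < y.
Proof.
move=> sA; split=> [[ubA lbA] x xa|uA]; last split.
- apply: contrapT => nA; have : a <= x; last by rewrite leNgt xa.
  apply: lbA => y Ay; rewrite leNgt; apply/negP => xy; by apply: nA; exists y.
- by move=> x /sA/ltW.
- move=> x ubx; rewrite leNgt; apply/negP => /uA[y /ubx].
  by rewrite leNgt => /negP.
Qed.

Lemma clubP a A : club a A <-> [/\ A `<=` below a,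
  forall x, x < a -> exists2 y, A y & x < y &
  forall x, x < a -> left_limit A x -> A x].
Proof.
split=> [[/closed_inP[sA lA] /(supremums_unbounded sA)]//|[sA uA lA]].
by split; [exact/closed_inP|exact/supremums_unbounded].
Qed.

End Topology.

(** * Cofinality and order types *)

Section Cofinality.
Context {d : Order.disp_t} {W : orderTopologicalType d} (wo : is_wo W).
Implicit Types (x y z a b nu lam kap : W) (A B C D L S : set W).

(** If the cardinality [c] of [x] exceeded [a], leastness of [b] would give [b <= c <= x]. *)
Lemma card_below_succ a b x : successor_cardinal a b -> x < b -> below x #<= below a.
Proof.
move=> [[cb ab] lb] xb; have [c [cx cc xc]] := ex_cardinal wo x.
apply: card_le_trans xc _; apply: subset_card_le => y yc.
apply: lt_le_trans yc _; rewrite leNgt; apply/negP => ac.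
have := lb c (conj cc ac); rewrite leNgt => /negP; apply; exact: le_lt_trans xb.
Qed.

Lemma succ_card_not_le a b : successor_cardinal a b -> ~ (below b #<= below a).
Proof. by move=> [[cb ab] _]; exact: cb. Qed.

Lemma succ_infinite a b : infinite_cardinal a -> successor_cardinal a b -> infinite_cardinal b.
Proof.
move=> [_ ia] [[cb ab] _]; split=> // fb; apply: ia; apply: sub_finite_set fb.
by move=> x xa; exact: lt_trans ab.
Qed.

Lemma card_set1_le {T : Type} a (t : T) : infinite_cardinal a -> [set t] #<= below a.
Proof.
move=> [_ /infinite_setN0[x xa]].
by apply: (surj_card (f := fun=> t)) => _ ->; exists x.
Qed.

(* a < cf(z) *)
Definition card_bounded a z : Prop := forall S, S `<=` below z -> S #<= below a ->
  exists2 x, x < z & S `<=` below x.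

(** Regularity of successor cardinals: an unbounded [S] would make [b] a union of at most [a] sets
    [x + 1], each of size at most [a]. *)
Lemma succ_bounded a b : infinite_cardinal a -> successor_cardinal a b -> card_bounded a b.
Proof.
move=> ia sb S Sb Sa; apply: contrapT => nS; apply: (succ_card_not_le sb).
apply: card_le_trans (card_bigcup (F := fun x => below x `|` [set x]) wo ia Sa _).
  apply: subset_card_le => x xb; apply: contrapT => nx; apply: nS; exists x => // s Ss.
  rewrite /below /= ltNge le_eqVlt; apply/negP => /orP[/eqP e|xs]; apply: nx; exists s => //.
    by right.
  by left.
move=> x Sx; apply: card_setU => //; last exact: card_set1_le.
by apply: card_below_succ sb _; exact: Sb.
Qed.

Lemma card_bounded_succ a z x : infinite_cardinal a -> card_bounded a z -> x < z ->
  exists2 y, y < z & x < y.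
Proof.
move=> ia bz xz; have [|y yz xy] := bz [set x] _ (card_set1_le _ ia); first by move=> _ ->.
by exists y => //; exact: xy.
Qed.

Lemma collapse_otp A (f : W -> W) u :
  (forall x y, A x -> A y -> x < y -> f x < f y) ->
  (forall x z, A x -> z < f x -> exists2 y, A y & f y = z) ->
  (forall x, A x -> f x < u) -> otp_le A u.
Proof.
move=> fA imf fu.
have [|n [nub ln]] := @ex_least _ _ wo [set z | forall x, A x -> f x < z]; first by exists u.
exists n; first exact: ln.
exists f; split.
  apply/seteqP; split => [_ [x Ax <-]|z zn]; first exact: nub.
  apply: contrapT => nz.
  have : n <= z; last by rewrite leNgt => /negP; apply.
  apply: ln => x Ax; rewrite ltNge le_eqVlt; apply/negP => /orP[/eqP e|zf]; apply: nz.
    by exists x.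
  by have [y Ay <-] := imf _ _ Ax zf; exists y.
move=> x y /set_mem Ax /set_mem Ay; case: (ltgtP x y) => [xy|yx|->].
- exact: fA.
- by apply/negbTE; rewrite -leNgt; apply/ltW/fA.
- by rewrite ltxx.
Qed.

Lemma otp_le_below A z : A `<=` below z -> otp_le A z.
Proof.
move=> Az; have [f [fle fA imf]] := ex_collapse wo A.
by apply: (collapse_otp fA imf) => x Ax; apply: le_lt_trans (fle _ Ax) (Az _ Ax).
Qed.

(** If the collapse reached a value [f x >= b], then all of [b] would be covered by values at
    elements of [A] before [x], of which there are at most [a]. *)
Lemma otp_le_succ a b A : successor_cardinal a b ->
  (forall x, A x -> A `&` below x #<= below a) -> otp_le A b.
Proof.
move=> sb cA; have [f [fle fA imf]] := ex_collapse wo A.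
apply: (collapse_otp fA imf) => x Ax; rewrite ltNge; apply/negP => bf.
apply: (succ_card_not_le sb); apply: card_le_trans (cA _ Ax).
apply: (surj_card (f := f)) => z zb.
have zf : z < f x by exact: lt_le_trans bf.
have [y Ay fy] := imf _ _ Ax zf; exists y => //; split => //.
rewrite /below /= ltNge le_eqVlt; apply/negP => /orP[/eqP e|xy].
  by move: zf; rewrite -fy e ltxx.
by have := fA _ _ Ax Ay xy; rewrite fy ltNge (ltW zf).
Qed.

Lemma has_otp_card A n : has_otp A n -> A #<= below n /\ below n #<= A.
Proof.
move=> [f [fA fm]]; rewrite -fA; split; last exact: card_image_le.
suff /inj_card_eq/card_eqPle[] : {in A &, injective f} by [].
move=> x y Ax Ay fxy; apply/eqP; rewrite eq_le !leNgt.
by rewrite -(fm _ _ Ax Ay) -(fm _ _ Ay Ax) fxy ltxx.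
Qed.

(** This lets later arguments use bounds on small subsets instead of order types of cofinal sets. *)
Lemma cof_setP nu lam kap z : infinite_cardinal nu ->
  successor_cardinal nu lam -> successor_cardinal lam kap ->
  cof_set kap lam z <-> z < kap /\ card_bounded nu z.
Proof.
move=> inu slam skap; split=> [[zk [_ lcf]]|[zk bz]]; split => //.
  move=> S Sz Snu; apply: contrapT => nS.
  have [n nz otpS] := otp_le_below Sz.
  have : lam <= n.
    apply: lcf; exists S => //; split=> // x xz; apply: contrapT => nx; apply: nS; exists x => // y Sy.
    rewrite /below /= ltNge; apply/negP => xy; by apply: nx; exists y.
  move=> lamn; apply: (succ_card_not_le slam); have [_ h] := has_otp_card otpS.
  apply: card_le_trans (card_le_trans h Snu); apply: subset_card_le => x xl; exact: lt_le_trans lamn.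
have cof_ge n : (exists2 A, cofinal_in z A & has_otp A n) -> lam <= n.
  move=> [A [Az cA] /has_otp_card[An _]]; rewrite leNgt; apply/negP => nlam.
  have [||x xz Ax] := bz A => //; first exact: card_le_trans An (card_below_succ slam nlam).
  by have [y Ay] := cA _ xz; rewrite leNgt => /negP; apply; exact: Ax.
split; last by move=> n /cof_ge.
have [g gz] := card_surj z (card_below_succ skap zk).
(* The records of the enumeration [g] of [z] by [lam]: values exceeding all earlier values below
   [z]. *)
pose A := [set y | y < z /\ exists2 i, i < lam & g i = y /\ forall j, j < i -> g j < z -> g j < y].
have Az : A `<=` below z by move=> x [].
have cofA : cofinal_in z A.
  split=> // x xz.
  (* The first index with value in the interval from [x] to [z] gives a record. *)
  have [|i [[il xi giz] li]] := @ex_least _ _ wo [set i | [/\ i < lam, x <= g i & g i < z]].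
    by have [i il gix] := gz _ xz; exists i; rewrite /= gix.
  exists (g i) => //; split => //; exists i => //; split=> // j ji gjz.
  rewrite ltNge; apply/negP => gij; have : i <= j; last by rewrite leNgt ji.
  by apply: li; split=> //; [exact: lt_trans il|exact: le_trans gij].
suff [n nlam otpA] : otp_le A lam.
  suff <- : n = lam by exists A.
  by apply/le_anti; rewrite nlam; apply: cof_ge; exists A.
(* Records below the record [g i] have indices below [i], so there are at most [nu] of them. *)
apply: (otp_le_succ slam) => x [xz [i il [gi gj]]].
apply: card_le_trans (card_below_succ slam il).
apply: (surj_card (f := g)) => y [[yz [j jl [gjy jlt]]] yx]; exists j => //.
rewrite /below /= ltNge le_eqVlt; apply/negP => /orP[/eqP ij|ij].
  by move: yx; rewrite /below /= -gjy -ij gi ltxx.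
have := jlt i ij; rewrite gi => /(_ xz) xy.
by move: yx; rewrite /below /= ltNge (ltW xy).
Qed.

End Cofinality.

(** * Clubs and ladders *)

Section Clubs.
Context {d : Order.disp_t} {W : orderTopologicalType d} (wo : is_wo W).
Context (a : W) (inf_a : infinite_cardinal a).
Implicit Types (x y z : W) (A B C D L S : set W).

(** Take the supremum of the iterates of [H] at [x]; it is below [z] since [z] has uncountable
    cofinality. Points chosen between [u] and [H u] then accumulate at [s]. *)
Lemma iter_sup z (H : W -> W) x : card_bounded a z ->
  (forall y, y < z -> y < H y < z) -> x < z ->
  exists s, [/\ s < z, x < s & forall y, y < s -> exists2 u, y < u < z & H u < s].
Proof.
move=> bz Hz xz; pose u n := iter n H x.
have uz n : u n < z by elim: n => //= n IH; have /andP[] := Hz _ IH.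
have uS n : u n < u n.+1 by have /andP[] := Hz _ (uz n).
have [||v vz uv] := bz (range u).
- by move=> _ [n _ <-]; exact: uz.
- exact: card_le_trans (card_image_le _ _) (card_nat_le inf_a).
have [|s [us ls]] := @ex_least _ _ wo [set s | forall n, u n <= s].
  by exists v => n; apply/ltW/uv; exists n.
exists s; split.
- by apply: le_lt_trans vz; apply: ls => n; apply/ltW/uv; exists n.
- exact: lt_le_trans (uS 0%N) (us _).
- move=> y ys; have [n yn] : exists n, y < u n.
    apply: contrapT => nn; have : s <= y; last by rewrite leNgt ys.
    by apply: ls => n; rewrite leNgt; apply/negP => yn; apply: nn; exists n.
  by exists (u n); [rewrite yn uz|exact: lt_le_trans (uS n.+1) (us _)].
Qed.

Lemma club_limits z A : card_bounded a z -> A `<=` below z ->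
  (forall x, x < z -> exists2 y, A y & x < y) ->
  club z [set x | x < z /\ left_limit A x].
Proof.
move=> bz Az uA; apply/(clubP wo); split=> [x []//|x xz|x xz [x0 lx]].
- have /choice[H HP] : forall y, exists y', y < z -> A y' /\ y < y'.
    move=> y; have [/uA[y' ? ?]|_] := boolP (y < z); first by exists y'.
    by exists y.
  have [|s [sz xs ls]] := iter_sup bz (H := H) _ xz.
    by move=> y yz; have [AH ->] := HP _ yz; exact: Az.
  exists s => //; split=> //; split; first by exists x.
  move=> y /ls[u /andP[yu uz] Hs]; have [AH uH] := HP _ uz.
  by exists (H u) => //; rewrite Hs (lt_trans yu).
- split=> //; split=> // y /lx[u [uz [_ lu]] /andP[yu ux]].
  have [v Av /andP[yv vu]] := lu _ yu.
  by exists v => //; rewrite yv (lt_trans vu).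
Qed.

(** The clause [x < z] makes the intersection over an empty [I] all of [z]. *)
Lemma club_bigcap z {U : Type} (I : set U) (F : U -> set W) : card_bounded a z ->
  I #<= below a -> (forall i, I i -> club z (F i)) ->
  club z [set x | x < z /\ forall i, I i -> F i x].
Proof.
move=> bz Ia cF; apply/(clubP wo); split=> [x []//|x xz|x xz lx].
(* [y'] lies beyond a point of every [F i] above [y], so suprema of iterates are limits of all [F i]
   at once. Including [y] among the points to bound gives [y < y'] also for empty [I]. *)
- have step y : exists y', y < z -> y < y' < z /\ forall i, I i -> exists2 w, F i w & y < w < y'.
    have [yz|_] := boolP (y < z); last by exists y.
    have /choice[g gP] : forall i, exists w, I i -> F i w /\ y < w.
      move=> i; have [Ii|nI] := pselect (I i); last by exists y.
      by have /(clubP wo)[_ /(_ _ yz)[w]] := cF _ Ii; exists w.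
    have [||y' y'z sy'] := bz (g @` I `|` [set y]).
    - move=> _ [[i Ii <-]|->] //; have [Fg _] := gP _ Ii.
      by have /(clubP wo)[/(_ _ Fg)] := cF _ Ii.
    - apply: card_setU => //; last exact: card_set1_le.
      exact: card_le_trans (card_image_le _ _) Ia.
    exists y' => _; rewrite y'z sy'; last by right.
    split=> // i Ii; have [Fg yg] := gP _ Ii; exists (g i) => //.
    by rewrite yg; apply: sy'; left; exists i.
  have [H HP] := choice step.
  have [|s [sz xs ls]] := iter_sup bz (H := H) _ xz.
    by move=> y /HP[].
  exists s => //; split=> // i Ii.
  have /(clubP wo)[_ _] := cF _ Ii; apply=> //; split; first by exists x.
  move=> y /ls[u /andP[yu uz] Hs]; have [_ /(_ _ Ii)[w Fw /andP[uw wH]]] := HP _ uz.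
  by exists w => //; rewrite (lt_trans yu)//= (lt_trans wH).
- split=> // i Ii; have /(clubP wo)[_ _] := cF _ Ii; apply=> //.
  by apply: left_limit_sub lx => y [_]; exact.
Qed.

Lemma clubI z A B : card_bounded a z -> club z A -> club z B -> club z (A `&` B).
Proof.
move=> bz cA cB; have := @club_bigcap z nat setT (fun n => if n is 0%N then A else B) bz.
move=> /(_ (card_nat_le inf_a)) h.
have -> : A `&` B = [set x | x < z /\ forall n : nat, setT n -> (if n is 0%N then A else B) x].
  apply/seteqP; split => x; last by move=> [_ h']; split; [exact: (h' 0%N)|exact: (h' 1%N)].
  by move=> [Ax Bx]; split; [have /(clubP wo)[/(_ _ Ax)] := cA|case].
by apply: h => -[|n] _.
Qed.

Lemma ex_next z L x : club z L -> x < z ->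
  exists y, [/\ least (L `\` upto x) y, L y, x < y & y < z].
Proof.
move=> /(clubP wo)[Lz uL _] xz.
have [|y yL] := @ex_least _ _ wo (L `\` upto x).
  by have [y Ly xy] := uL _ xz; exists y; split=> //; rewrite /upto /= leNgt xy.
exists y; have [[Ly xy] _] := yL; split => //; last exact: Lz.
by rewrite ltNge; exact/negP.
Qed.

Lemma not_stationary z S : S `<=` below z -> ~ stationary z S ->
  exists2 c, club z c & forall x, c x -> ~ S x.
Proof.
move=> Sz nS; apply: contrapT => nc; apply: nS; split=> // c cc.
apply: contrapT => ne; apply: nc; exists c => // x cx Sx; apply: ne; by exists x.
Qed.

End Clubs.

(** * Ladders and stationarily many gaps that meet a club *)

Section Guessing.
Context {d : Order.disp_t} {W : orderTopologicalType d} (wo : is_wo W).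
Context (nu lam kap : W) (inf_nu : infinite_cardinal nu).
Context (lamE : successor_cardinal nu lam) (kapE : successor_cardinal lam kap).
Implicit Types (x y z : W) (A B D L S : set W) (C : W -> set W).
Local Notation E := (cof_set kap lam).

Lemma cof_bounded z : E z -> card_bounded nu z.
Proof. by move=> /(cof_setP wo _ inf_nu lamE kapE)[]. Qed.

Lemma kap_bounded : card_bounded nu kap.
Proof.
move=> S Sk Snu; apply: (succ_bounded wo (succ_infinite inf_nu lamE) kapE) => //.
apply: card_le_trans Snu _; apply: subset_card_le => x xn.
by apply: lt_trans xn _; case: lamE => -[].
Qed.

(** [z] is the supremum of the first [lam] elements of [A] above [x]; its cofinality exceeds [nu]
    because [lam] is regular. *)
Lemma ex_cof_limit A x : A `<=` below kap ->
  (forall y, y < kap -> exists2 z, A z & y < z) -> x < kap ->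
  exists z, [/\ E z, x < z & left_limit A z].
Proof.
move=> Ak uA xk; have inf_lam := succ_infinite inf_nu lamE.
pose A' := A `\` upto x.
have [f [_ fA imf]] := ex_collapse wo A'.
have f_inj : {in A' &, injective f}.
  move=> y z /set_mem Ay /set_mem Az fyz; case: (ltgtP y z) => // h.
    by have := fA _ _ Ay Az h; rewrite fyz ltxx.
  by have := fA _ _ Az Ay h; rewrite fyz ltxx.
have f_lt y z : A' y -> A' z -> f y < f z -> y < z.
  move=> Ay Az fyz; case: (ltgtP y z) => // h.
    by have := fA _ _ Az Ay h; rewrite ltNge (ltW fyz).
  by move: fyz; rewrite h ltxx.
(* Otherwise [A'] would have at most [lam] elements and be bounded in [kap]. The element [a0] keeps
   [z] below [kap] and makes every index below [lam] occur. *)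
have [a0 A'a0 lam_a0] : exists2 a0, A' a0 & lam <= f a0.
  apply: contrapT => na0.
  have A'lam : A' #<= below lam.
    have /card_eqPle[_ h] := inj_card_eq f_inj.
    apply: card_le_trans h _; apply: subset_card_le => _ [y Ay <-].
    by rewrite /below /= ltNge; apply/negP => lf; apply: na0; exists y.
  have [|y yk A'y] := succ_bounded wo inf_lam kapE _ A'lam.
    by move=> y [/Ak].
  have mk : Order.max x y < kap by rewrite gt_max xk yk.
  have [z Az] := uA _ mk; rewrite gt_max => /andP[xz yz].
  have : z < y by apply: A'y; split=> //; rewrite /upto /= leNgt xz.
  by rewrite ltNge (ltW yz).
pose B := [set b | A' b /\ f b < lam].
(* The indices of at most [nu] elements of [B] are bounded by some [t < lam], and the element of
   index [t] is above them all. *)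
have hB S : S `<=` B -> S #<= below nu -> exists2 c, B c & forall s, S s -> s < c.
  move=> SB Snu; have [||t tlam St] := succ_bounded wo inf_nu lamE (S := f @` S).
  - by move=> _ [s /SB[_ ?] <-].
  - exact: card_le_trans (card_image_le _ _) Snu.
  have [c A'c fc] := imf _ _ A'a0 (lt_le_trans tlam lam_a0).
  exists c; first by split=> //; rewrite fc.
  move=> s Ss; apply: f_lt => //; first by have [] := SB _ Ss.
  by rewrite fc; apply: St; exists s.
have hB1 b : B b -> exists2 c, B c & b < c.
  move=> Bb; have [||c Bc bc] := hB [set b]; first by move=> _ ->.
    exact: card_set1_le.
  by exists c => //; exact: bc.
have [|z [ubz lz]] := @ex_least _ _ wo [set z | forall b, B b -> b <= z].
  exists a0 => b [A'b fb]; apply/ltW/f_lt => //; exact: lt_le_trans lam_a0.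
have Bz b : B b -> b < z.
  by move=> /hB1[c Bc bc]; exact: lt_le_trans bc (ubz _ Bc).
have lBz y : y < z -> exists2 b, B b & y < b.
  move=> yz; apply: contrapT => nb; have : z <= y; last by rewrite leNgt yz.
  by apply: lz => b Bb; rewrite leNgt; apply/negP => yb; apply: nb; exists b.
have [b0 Bb0 _] : exists2 c, B c & forall s, set0 s -> s < c.
  by apply: hB => //; exact: card_ge0.
have xb b : B b -> x < b by move=> [[_ /negP]]; rewrite -ltNge.
have xz : x < z by exact: lt_trans (xb _ Bb0) (Bz _ Bb0).
exists z; split=> //; last first.
  split; first by exists x.
  by move=> y /lBz[b Bb yb]; exists b; [case: Bb => -[]|rewrite yb Bz].
apply/(cof_setP wo _ inf_nu lamE kapE); split.
  have za0 : z <= a0.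
    by apply: lz => b [A'b fb]; apply/ltW/f_lt => //; exact: lt_le_trans lam_a0.
  apply: le_lt_trans za0 _; exact: Ak A'a0.1.
move=> S Sz Snu.
have /choice[g gP] : forall s, exists b, S s -> B b /\ s < b.
  move=> s; have [Ss|nS] := pselect (S s); last by exists s.
  by have [b] := lBz _ (Sz _ Ss); exists b.
have [||c Bc gc] := hB (g @` S).
- by move=> _ [s Ss <-]; have [] := gP _ Ss.
- exact: card_le_trans (card_image_le _ _) Snu.
exists c; first exact: Bz.
by move=> s Ss; have [_ /lt_trans] := gP _ Ss; apply; apply: gc; exists s.
Qed.

(** The last clause stands in for order type [lam]: it passes to subsets and gives order type at
    most [lam] by [otp_le_succ]. *)
Definition ladder z L : Prop := [/\ club z L, forall x, L x -> ~ E x &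
  forall x, x < z -> L `&` below x #<= below nu].

Lemma ladder_clubI z L c : E z -> ladder z L -> club z c -> ladder z (L `&` c).
Proof.
move=> Ez [cL LE sL] cc; split=> [|x [/LE]//|x xz].
  exact: (clubI wo inf_nu (cof_bounded Ez)).
apply: card_le_trans (sL _ xz); apply: subset_card_le; exact: setSI.
Qed.

(** Take the limits of a cofinal set [A] of type [lam]. Below such a limit [x < z], at most [nu]
    elements of [A] are cofinal in [x], so [x] is not in [E]. *)
Lemma ex_ladder z : E z -> exists L, ladder z L.
Proof.
move=> Ez; have bz := cof_bounded Ez; have [zk [[A [Az cA] [f [fA fm]]] _]] := Ez.
have uA x : x < z -> exists2 y, A y & x < y.
  move=> xz; have [y yz xy] := card_bounded_succ inf_nu bz xz.
  by have [w Aw yw] := cA _ yz; exists w => //; exact: lt_le_trans yw.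
have smallA x : x < z -> A `&` below x #<= below nu.
  move=> /uA[y Ay xy].
  have f_inj : {in A `&` below x &, injective f}.
    move=> u v /set_mem[Au _] /set_mem[Av _] fuv; apply/eqP; rewrite eq_le !leNgt.
    by rewrite -(fm _ _ (mem_set Au) (mem_set Av)) -(fm _ _ (mem_set Av) (mem_set Au)) fuv ltxx.
  have /card_eqPle[_ h] := inj_card_eq f_inj.
  apply: card_le_trans h _.
  have fy : f y < lam by have : (f @` A) (f y) by [exists y]; rewrite fA.
  apply: card_le_trans (card_below_succ wo lamE fy); apply: subset_card_le => _ [u [Au ux] <-].
  by rewrite /below /= (fm _ _ (mem_set Au) (mem_set Ay)); exact: lt_trans xy.
exists [set x | x < z /\ left_limit A x]; split.
- exact: (club_limits wo inf_nu bz).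
- move=> x [xz [_ lx]] Ex.
  have [|y yx Ay] := cof_bounded Ex _ (smallA _ xz); first by move=> u [].
  have [w Aw /andP[yw wx]] := lx _ yx.
  by have := Ay w (conj Aw wx); rewrite /below /= ltNge (ltW yw).
- move=> x xz; have [w Aw xw] := uA _ xz; have wz := Az _ Aw.
  (* Sending a limit of [A] to the next element of [A] is injective, as [A] has an element between
     any two limits; so the limits are as few as the elements of [A]. *)
  have /choice[h hP] : forall y, exists b, left_limit A y -> y < x -> least [set u | A u /\ y < u] b.
    move=> y; have [yx|_] := boolP (y < x); last by exists y.
    have [|m mP] := @ex_least _ _ wo [set u | A u /\ y < u]; last by exists m.
    by exists w; split=> //; exact: lt_trans xw.
  have h_inj : {in [set y | y < z /\ left_limit A y] `&` below x &, injective h}.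
    suff H u v : left_limit A u -> left_limit A v -> v < x -> u < v -> h u < h v.
      move=> u v /set_mem[[_ lu] ux] /set_mem[[_ lv] vx] huv; case: (ltgtP u v) => // uv.
        by have := H _ _ lu lv vx uv; rewrite huv ltxx.
      by have := H _ _ lv lu ux uv; rewrite huv ltxx.
    move=> lu lv vx uv; have ux := lt_trans uv vx.
    have [_ lhu] := hP _ lu ux; have [[_ vhv] _] := hP _ lv vx.
    have [b Ab /andP[ub bv]] := lv.2 _ uv.
    by apply: le_lt_trans (lhu _ (conj Ab ub)) _; exact: lt_trans vhv.
  have /card_eqPle[_ /card_le_trans] := inj_card_eq h_inj; apply.
  have [w' w'z ww'] := card_bounded_succ inf_nu bz wz.
  apply: card_le_trans (smallA _ w'z); apply: subset_card_le => _ [y [[_ ly] yx] <-].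
  have [[Ah _] lh] := hP _ ly yx; split=> //.
  by apply: le_lt_trans ww'; apply: lh; split=> //; exact: lt_trans xw.
Qed.

(* Otherwise shrink the ladders omega many times, each time by clubs that
   witness the failure for some club of kap.  Let D be the intersection of these
   clubs of kap and L that of the ladders at a limit z of D `&` E; pick w in
   D `&` E below z and let b be the largest element of L below w.  The successors
   of b in the shrinking ladders stay below w, and as w has uncountable
   cofinality they increase to an element of L strictly between b and w. *)
Lemma nonempty_gaps : exists C, (forall z, E z -> ladder z (C z)) /\
  forall D, club kap D -> exists2 z, E z & stationary z
    [set b | b < z /\ exists w g, [/\ least (C z `\` upto b) g, D w, E w & b < w < g]].
Proof.
apply: contrapT => ngap.
(* For a ladder system [C], [(G C).1] is a club of [kap] at which it fails, and the club [(G C).2 z]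
   contains no [b] whose gap meets that club and [E]. *)
have /choice[G GP] : forall C, exists p : set W * (W -> set W),
    (forall z, E z -> ladder z (C z)) -> club kap p.1 /\
    forall z, E z -> club z (p.2 z) /\ forall b, p.2 z b -> forall w g,
      least (C z `\` upto b) g -> p.1 w -> E w -> ~ (b < w < g).
  move=> C; have [lC|] := pselect (forall z, E z -> ladder z (C z)); last first.
    by exists (set0, fun=> set0).
  have [D [cD nD]] : exists D, club kap D /\ ~ exists2 z, E z & stationary z
    [set b | b < z /\ exists w g, [/\ least (C z `\` upto b) g, D w, E w & b < w < g]].
    apply: contrapT => nD; apply: ngap; exists C; split=> // D cD.
    by apply: contrapT => nz; apply: nD; exists D.
  have /choice[c cP] : forall z, exists c, E z -> club z c /\ forall b, c b -> forall w g,
      least (C z `\` upto b) g -> D w -> E w -> ~ (b < w < g).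
    move=> z; have [Ez|] := pselect (E z); last by exists set0.
    have [||c cc cS] := @not_stationary _ W z [set b | b < z /\ exists w g, [/\ least (C z `\` upto b) g, D w, E w & b < w < g]].
    - by move=> b [].
    - by move=> sz; apply: nD; exists z.
    exists c => _; split=> // b cb w g bg Dw Ew bwg; apply: (cS _ cb); split.
      by have /(clubP wo)[/(_ _ cb)] := cc.
    by exists w, g.
  by exists (D, c).
have /choice[C0 C0P] : forall z, exists L, E z -> ladder z L.
  by move=> z; have [/ex_ladder[L]|] := pselect (E z); [exists L|exists set0].
pose Cn := fix Cn n := if n is m.+1 then fun z => Cn m z `&` (G (Cn m)).2 z else C0.
have lCn n : forall z, E z -> ladder z (Cn n z).
  elim: n => [|n IH] z Ez; first exact: C0P.
  by apply: ladder_clubI; [|exact: IH|have [_ /(_ _ Ez)[]] := GP _ IH].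
pose D := [set x | x < kap /\ forall n : nat, setT n -> (G (Cn n)).1 x].
have cD : club kap D.
  apply: (club_bigcap wo inf_nu kap_bounded (card_nat_le inf_nu)) => n _.
  by have [] := GP _ (lCn n).
have /(clubP wo)[Dk uD lD] := cD.
have uDE x : x < kap -> exists2 y, (D `&` E) y & x < y.
  move=> xk; have [z [Ez xz lz]] := ex_cof_limit Dk uD xk.
  exists z => //; split=> //; apply: lD => //; by case: Ez.
have nuk : nu < kap by case: lamE kapE => -[_ h] _ [[_ h'] _]; exact: lt_trans h'.
have [|z [Ez _ lz]] := @ex_cof_limit (D `&` E) nu _ uDE nuk.
  by move=> x [/Dk].
pose L := [set x | x < z /\ forall n : nat, setT n -> Cn n z x].
have cL : club z L.
  apply: (club_bigcap wo inf_nu (cof_bounded Ez) (card_nat_le inf_nu)) => n _.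
  by have [] := lCn n _ Ez.
have /(clubP wo)[Lz uL lL] := cL.
(* The point [x0] of [L] below [w] makes the supremum [b] of [L] below [w] a genuine one, so that
   closedness puts it in [L]. *)
have [[x1 x1z] _] := lz; have [x0 Lx0 _] := uL _ x1z.
have [w [Dw Ew] /andP[x0w wz]] := lz.2 _ (Lz _ Lx0).
have [||y yw Ly] := cof_bounded Ew (S := L `&` below w).
- by move=> x [].
- have [_ _ /(_ _ wz) h] := lCn 0%N _ Ez; apply: card_le_trans h; apply: subset_card_le => x [[_ Lx] xw].
  by split=> //; exact: (Lx 0%N).
have [|b [ubb lb]] := @ex_least _ _ wo [set b | forall x, L x -> x < w -> x <= b].
  by exists y => x Lx xw; apply/ltW/Ly.
have bw : b < w by apply: le_lt_trans yw; apply: lb => x Lx xw; apply/ltW/Ly.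
have bz : b < z by exact: lt_trans wz.
have Lb : L b.
  apply: contrapT => nLb; apply: (nLb); apply: lL => //; split.
    exists x0; rewrite lt_neqAle ubb// andbT; apply/eqP => e; apply: nLb; by rewrite -e.
  move=> u ub; apply: contrapT => nx; have : b <= u; last by rewrite leNgt ub.
  apply: lb => x Lx xw; rewrite leNgt; apply/negP => ux; apply: nx; exists x => //.
  rewrite ux lt_neqAle ubb// andbT; apply/eqP => e; apply: nLb; by rewrite -e.
have /choice[g gP] : forall n, exists g, [/\ least (Cn n z `\` upto b) g, Cn n z g, b < g & g < z].
  by move=> n; apply: (ex_next wo _ bz); have [] := lCn n _ Ez.
(* As [b] is in [L], it is in the club that shrinks [Cn n], so its gap in [Cn n z] does not contain
   [w]; and [g n] is not [w] because ladders avoid [E]. *)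
have gw n : g n < w.
  have [bg Cg bgn gz] := gP n; have [_ nE _] := lCn n _ Ez.
  have : g n <= w.
    rewrite leNgt; apply/negP => wg.
    have [_ /(_ _ Ez)[_ noguess]] := GP _ (lCn n).
    apply: (noguess b _ w _ bg _ Ew); last by rewrite bw.
      by have [_ /(_ n.+1 I)[]] := Lb.
    by have [_ /(_ n I)] := Dw.
  by rewrite le_eqVlt => /orP[/eqP e|//]; case: (nE _ Cg); rewrite e.
have Csub m n : (m <= n)%N -> Cn n z `<=` Cn m z.
  move=> /subnK <-; elim: (n - m)%N => //= k IH x [/IH]//.
have [||v vw gv] := cof_bounded Ew (S := range g).
- by move=> _ [n _ <-]; exact: gw.
- exact: card_le_trans (card_image_le _ _) (card_nat_le inf_nu).
have [|s [gs ls]] := @ex_least _ _ wo [set s | forall n, g n <= s].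
  by exists v => n; apply/ltW/gv; exists n.
have sw : s < w by apply: le_lt_trans vw; apply: ls => n; apply/ltW/gv; exists n.
have bs : b < s by have [_ _ bg _] := gP 0%N; exact: lt_le_trans bg (gs _).
suff Ls : L s by have := ubb _ Ls sw; rewrite leNgt bs.
have sz := lt_trans sw wz; split=> // n _.
have [/(clubP wo)[_ _ lC] _ _] := lCn n _ Ez.
apply: contrapT => nCs; apply: (nCs); apply: lC => //; split; first by exists b.
move=> u us; apply: contrapT => nx; have : s <= u; last by rewrite leNgt us.
(* Since the ladders decrease, [g (maxn m n)] is in [Cn n z] and at least [g m]; such points witness
   that [s] is a limit of [Cn n z]. *)
apply: ls => m; apply: (@le_trans _ _ (g (maxn m n))).
  have [[_ lg] _ _ _] := gP m; apply: lg; have [_ Cg bg _] := gP (maxn m n).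
  split; last by rewrite /upto /= leNgt bg.
  by apply: Csub Cg; exact: leq_maxl.
rewrite leNgt; apply/negP => ug; apply: nx; exists (g (maxn m n)).
  have [_ Cg _ _] := gP (maxn m n); apply: Csub Cg; exact: leq_maxr.
rewrite ug lt_neqAle gs andbT; apply/eqP => e; apply: nCs; rewrite -e.
have [_ Cg _ _] := gP (maxn m n); apply: Csub Cg; exact: leq_maxr.
Qed.

End Guessing.

(** * Guessing clubs *)

Section Descent.
Context {d : Order.disp_t} {W : orderTopologicalType d} (wo : is_wo W).
Implicit Types (x y z w g b a : W) (A B D L S : set W).

(** If [D] has no point up to [z], this is the least ordinal. The default is never taken, as [z] is
    always a bound. *)
Definition sup_upto D z : W :=
  xget z (least [set u | forall y, D y -> y <= z -> y <= u]).

Lemma sup_uptoP D z : least [set u | forall y, D y -> y <= z -> y <= u] (sup_upto D z).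
Proof. by apply: xgetPex; apply: ex_least => //; exists z. Qed.

Lemma sup_upto_le D z : sup_upto D z <= z.
Proof. by apply: (sup_uptoP D z).2. Qed.

Lemma le_sup_upto D z y : D y -> y <= z -> y <= sup_upto D z.
Proof. exact: (sup_uptoP D z).1. Qed.

Lemma sup_upto_sub A B z : A `<=` B -> sup_upto A z <= sup_upto B z.
Proof. by move=> AB; apply: (sup_uptoP A z).2 => y /AB; exact: le_sup_upto. Qed.

Lemma club_sup_upto D k z w : club k D -> z < k -> D w -> w <= z -> D (sup_upto D z).
Proof.
move=> /(clubP wo)[_ _ lD] zk Dw wz; set s := sup_upto D z.
have sz : s <= z := sup_upto_le D z.
apply: contrapT => nDs; apply: (nDs); apply: lD; first exact: le_lt_trans zk.
have lts y : D y -> y <= z -> y < s.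
  move=> Dy yz; rewrite lt_neqAle le_sup_upto// andbT; apply/eqP => e.
  by apply: nDs; rewrite -e.
split; first by exists w; exact: lts.
move=> y ys; apply: contrapT => ny; have : s <= y; last by rewrite leNgt ys.
apply: (sup_uptoP D z).2 => x Dx xz; rewrite leNgt; apply/negP => yx.
by apply: ny; exists x => //; rewrite yx lts.
Qed.

Lemma nonincreasing_stable (u : nat -> W) : (forall n, u n.+1 <= u n) ->
  exists N, forall n, (N <= n)%N -> u n = u N.
Proof.
move=> uS; have umono m n : (m <= n)%N -> u n <= u m.
  by move=> /subnK <-; elim: (n - m)%N => //= k IH; exact: le_trans (uS _) IH.
have [|v [[N _ uN] lv]] := @ex_least _ _ wo (range u); first by exists (u 0%N); exists 0%N.
exists N => n Nn; apply/le_anti; rewrite umono//= uN; apply: lv; by exists n.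
Qed.

(* The k successive choices of an index for psi are coded by the single j,
   decoded by the pairing q. *)
Fixpoint descent (psi : W -> W -> W) (q : W -> W * W) D (k : nat) z (j : W) : W :=
  if k is k'.+1 then descent psi q D k' (psi (sup_upto D z) (q j).1) (q j).2
  else sup_upto D z.

(** A proposal [w g] outside its gap is discarded, so an arbitrary [w] adds at most one point per
    gap. *)
Definition insert (w : W -> W) L : set W :=
  L `|` [set y | exists b g, [/\ L b, least (L `\` upto b) g, y = w g & b < y < g]].

Lemma least_above L b g : least (L `\` upto b) g -> [/\ L g, b < g & forall y, L y -> b < y -> g <= y].
Proof.
move=> [[Lg bg] lg]; split=> //; first by rewrite ltNge; exact/negP.
by move=> y Ly yb; apply: lg; split=> //; rewrite /upto /= leNgt yb.
Qed.

Lemma insert_least (w : W -> W) L b g : L b -> least (L `\` upto b) g -> b < w g < g ->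
  least (insert w L `\` upto b) (w g).
Proof.
move=> Lb bg /[dup] bwg /andP[bw wg]; split.
  by split; [right; exists b, g|rewrite /upto /= leNgt bw].
have [Lg _ lg] := least_above bg.
move=> y [Ly]; rewrite /upto /= => /negP; rewrite -ltNge => yb.
case: Ly => [Ly|[b' [g' [Lb' bg' yw /andP[b'y yg']]]]].
  exact: le_trans (ltW wg) (lg _ Ly yb).
have [Lg' _ lg'] := least_above bg'.
case: (ltgtP b b') => [bb'|b'b|ebb'].
- by apply: le_trans (ltW wg) _; apply: le_trans (lg _ Lb' bb') (ltW b'y).
- by have := lg' _ Lb b'b; rewrite leNgt (lt_trans yb).
- by rewrite yw; subst b'; rewrite (least_uniq bg bg').
Qed.

(** A limit of the enlarged set is a limit of [L]: in an interval without points of [L], two new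
    points would belong to the same gap. *)
Lemma club_insert (w : W -> W) L z : club z L -> club z (insert w L).
Proof.
move=> /[dup] cL /(clubP wo)[Lz uL lL]; apply/(clubP wo); split.
- move=> y [/Lz//|[b [g [_ /least_above[/Lz gz _ _] _ /andP[_ yg]]]]].
  exact: lt_trans gz.
- by move=> x /uL[y Ly xy]; exists y => //; left.
move=> x xz [x0 lx]; left; apply: lL => //; split=> // y yx.
apply: contrapT => ny.
have new u v : y < u -> u < v -> v < x -> insert w L u -> insert w L v -> False.
  move=> yu uv vx iu iv; have noL t : L t -> y < t -> t < x -> False.
    by move=> Lt yt tx; apply: ny; exists t => //; rewrite yt.
  case: iu => [Lu|[b [g [Lb bg uw /andP[bu ug]]]]].
    by apply: (noL u) => //; exact: lt_trans vx.
  case: iv => [Lv|[b' [g' [Lb' bg' vw /andP[b'v vg']]]]].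
    by apply: (noL v) => //; exact: lt_trans uv.
  have [Lg _ lg] := least_above bg; have [Lg' _ lg'] := least_above bg'.
  have by_ : b <= y by rewrite leNgt; apply/negP => yb; apply: (noL b) => //; exact: lt_trans (lt_trans uv vx).
  have b'y : b' <= y by rewrite leNgt; apply/negP => yb; apply: (noL b') => //; exact: lt_trans vx.
  case: (ltgtP b b') => [bb'|b'b|ebb'].
  - by have := lg _ Lb' bb'; rewrite leNgt (le_lt_trans b'y (lt_trans yu ug)).
  - by have := lg' _ Lb b'b; rewrite leNgt (le_lt_trans by_ (lt_trans (lt_trans yu uv) vg')).
  - by subst b'; move: uv; rewrite uw vw (least_uniq bg bg') ltxx.
have [u iu /andP[yu ux]] := lx _ yx; have [v iv /andP[uv vx]] := lx _ ux.
exact: new iu iv.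
Qed.

(** A new point is determined by the lower end of its gap, an element of [L] below it. *)
Lemma card_insert a (w : W -> W) L z : infinite_cardinal a -> club z L ->
  (forall x, x < z -> L `&` below x #<= below a) ->
  forall x, x < z -> insert w L `&` below x #<= below a.
Proof.
move=> inf_a cL sL x xz; pose next b := xget z (least (L `\` upto b)).
suff /subset_card_le/card_le_trans : insert w L `&` below x `<=`
    (L `&` below x) `|` (w \o next) @` (L `&` below x).
  apply; apply: card_setU => //; first exact: sL.
  exact: card_le_trans (card_image_le _ _) (sL _ xz).
move=> y [[Ly|[b [g [Lb bg yw /andP[yb yg]]]]] yx]; first by left.
right; exists b; first by split=> //; exact: lt_trans yx.
by rewrite yw /=; congr w; apply: (least_uniq _ bg); apply: xgetPex; exists g.
Qed.

End Descent.

(** * Stabilizing descents and the diagonal argument *)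

Section Conclusion.
Context {d : Order.disp_t} {W : orderTopologicalType d} (wo : is_wo W).
Context (nu lam kap : W) (inf_nu : infinite_cardinal nu).
Context (lamE : successor_cardinal nu lam) (kapE : successor_cardinal lam kap).
Implicit Types (x y z w g b a : W) (A B D L S : set W).
Local Notation E := (cof_set kap lam).

(** Outside [E], some set of at most [nu] points is unbounded in [z]. The weak inequality
    [x <= psi z i] covers successor [z]. *)
Lemma ex_cofinal_maps : exists psi : W -> W -> W,
  forall z, z < kap -> ~ E z -> forall x, x < z -> exists2 i, i < nu & x <= psi z i < z.
Proof.
suff /choice[psi psiP] : forall z, exists f : W -> W, z < kap -> ~ E z -> forall x, x < z ->
  exists2 i, i < nu & x <= f i < z by exists psi.
move=> z; apply: contrapT => nf; apply: nf; have [zk|] := boolP (z < kap); last first.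
  by exists id.
have [Ez|nEz] := pselect (E z); first by exists id.
have [S [Sz Snu nS]] : exists S, [/\ S `<=` below z, S #<= below nu & ~ exists2 x, x < z & S `<=` below x].
  apply: contrapT => nS; apply: nEz; apply/(cof_setP wo _ inf_nu lamE kapE); split=> // S Sz Snu.
  by apply: contrapT => nx; apply: nS; exists S.
have [f Sf] := card_surj z Snu; exists f => _ _ x xz.
apply: contrapT => nx; apply: nS; exists x => // y Sy; rewrite /below /= ltNge; apply/negP => xy.
have [i inu fi] := Sf _ Sy; apply: nx; exists i => //; rewrite fi xy.
exact: Sz.
Qed.

(** By induction on [z]: the suprema stabilize at some [v >= w], and if [v] is not in [E], a step of
    [psi] leads to a smaller point still at or above [w]. So one pair [k], [j] serves for almost all
    [n]. *)
Lemma ex_descent (psi : W -> W -> W) (q : W -> W * W) (D : nat -> set W) w z :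
  (forall z, z < kap -> ~ E z -> forall x, x < z -> exists2 i, i < nu & x <= psi z i < z) ->
  below nu `*` below nu `<=` q @` below nu ->
  (forall n, club kap (D n)) -> (forall n, D n.+1 `<=` D n) -> (forall n, D n w) -> E w ->
  z < kap -> w <= z ->
  exists k j v N, [/\ j < nu, E v, w <= v, v <= z &
    forall n, (N <= n)%N -> descent psi q (D n) k z j = v /\ D n v].
Proof.
move=> psiP qP cD decD Dw Ew; elim/(wo_ind wo): z => z IH zk wz.
have [N stable] := nonincreasing_stable wo (u := fun n => sup_upto (D n) z)
  (fun n => sup_upto_sub wo z (decD n)).
set v := sup_upto (D N) z in stable.
have vz : v <= z := sup_upto_le wo _ _.
have wv : w <= v by exact: le_sup_upto.
have Dv n : (N <= n)%N -> D n v.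
  by move=> Nn; rewrite -(stable _ Nn); exact: (club_sup_upto wo (cD n) zk (Dw n) wz).
have [Ev|nEv] := pselect (E v).
  have [_ /infinite_setN0[j jnu]] := inf_nu.
  (* A descent of length zero reads no index, so any [j] below [nu] will do. *)
  exists 0%N, j, v, N; split=> // n Nn; split; [exact: stable|exact: Dv].
have wv' : w < v by rewrite lt_neqAle wv andbT; apply/eqP => e; apply: nEv; rewrite -e.
have vk := le_lt_trans vz zk.
have [i inu /andP[wi iv]] := psiP _ vk nEv _ wv'.
have [k [j [v' [N' [jnu Ev' wv'' v'i desc]]]]] := IH _ (lt_le_trans iv vz) (lt_trans iv vk) wi.
have [j' j'nu qj'] := qP (i, j) (conj inu jnu).
exists k.+1, j', v', (maxn N N'); split=> //.
  exact: le_trans (ltW (le_lt_trans v'i iv)) vz.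
move=> n; rewrite geq_max => /andP[Nn N'n] /=.
by rewrite qj' (stable _ Nn); exact: desc.
Qed.

Lemma club_guessing : exists C : W -> set W,
  [/\ C_sequence E C, bounded_seq lam E C &
    forall D, club kap D -> exists2 z, E z & stationary z
      [set b | b < z /\ exists2 g, least (C z `\` upto b) g & (D `&` E) g]].
Proof.
apply: contrapT => nguess.
have [C [lC gapC]] := nonempty_gaps wo inf_nu lamE kapE.
have [psi psiP] := ex_cofinal_maps.
have [q qP] := card_surj (kap, kap) (card_squared wo inf_nu).
have inf_lam := succ_infinite inf_nu lamE.
have bE z : E z -> card_bounded nu z := @cof_bounded _ _ wo _ _ _ inf_nu lamE kapE z.
have bkap := kap_bounded wo inf_nu lamE kapE.
pose C' D k j z := insert (fun g => descent psi q D k g j) (C z).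
(* Every candidate is a [lam]-bounded C-sequence whatever [D] is, so it can fail only at
   guessing. *)
have fails D k j : exists D', club kap D' /\ forall z, E z -> exists2 c, club z c &
    forall b, c b -> forall g, least (C' D k j z `\` upto b) g -> ~ (D' `&` E) g.
  apply: contrapT => nD; apply: nguess; exists (C' D k j).
  have cC' z : E z -> club z (C' D k j z).
    by move=> Ez; apply: club_insert => //; have [] := lC _ Ez.
  split.
  - split=> [z Ez|z /cC'//].
    have bz := bE _ Ez; split.
      by have [||x xz _] := bz set0; [|exact: card_ge0|exists x].
    by move=> x xz; have [y yz xy] := card_bounded_succ inf_nu bz xz; exists y.
  - move=> z Ez; apply: (otp_le_succ wo lamE) => x C'x; have [cC _ sC] := lC _ Ez.
    apply: (card_insert wo _ inf_nu cC sC).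
    by have /(clubP wo)[/(_ _ C'x)] := cC' _ Ez.
  - move=> D' cD'; apply: contrapT => nz; apply: nD; exists D'; split=> // z Ez.
    have [||c cc cS] := @not_stationary _ W z
      [set b | b < z /\ exists2 g, least (C' D k j z `\` upto b) g & (D' `&` E) g].
    + by move=> b [].
    + by move=> sz; apply: nz; exists z.
    exists c => // b cb g bg D'g; apply: (cS _ cb); split; last by exists g.
    by have /(clubP wo)[/(_ _ cb)] := cc.
(* One club below [D] defeats all candidates built from [D]: intersect the witnesses over the at
   most [nu] pairs [k], [j]. *)
have /choice[G GP] : forall D, exists D', club kap D -> [/\ club kap D', D' `<=` D &
    forall k j, j < nu -> forall z, E z -> exists2 c, club z c &
    forall b, c b -> forall g, least (C' D k j z `\` upto b) g -> ~ (D' `&` E) g].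
  move=> D; have [cD|nD] := pselect (club kap D); last by exists set0.
  have /choice[F FP] := fun p : nat * W => fails D p.1 p.2.
  pose D' := [set x | x < kap /\ forall k : nat, setT k ->
     [set x | x < kap /\ forall j, below nu j -> F (k, j) x] x].
  exists (D `&` D') => _; split=> [|x []//|k j jnu z Ez].
    apply: (clubI wo inf_nu bkap cD).
    apply: (club_bigcap wo inf_nu bkap (card_nat_le inf_nu)) => k _.
    apply: (club_bigcap wo inf_nu bkap (card_lexx _)) => j _.
    by have [] := FP (k, j).
  have [_ /(_ _ Ez)[c cc cP]] := FP (k, j); exists c => // b cb g bg [[_ D'g] Eg].
  apply: (cP _ cb _ bg); split=> //.
  by have [_ /(_ k I)[_ /(_ j jnu)]] := D'g.
pose D n := iter n G (below kap).
have cD n : club kap (D n).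
  elim: n => [|n IH] /=; last by have [] := GP _ IH.
  apply/(clubP wo); split=> // x xk.
  by have [y yk xy] := card_bounded_succ inf_nu bkap xk; exists y.
have decD n : D n.+1 `<=` D n by have [] := GP _ (cD n).
have cDw := club_bigcap wo inf_nu bkap (card_nat_le inf_nu) (F := D) (fun n _ => cD n).
have [z Ez [_ stat_z]] := gapC _ cDw.
have bz := bE _ Ez; have [cC nEC _] := lC _ Ez.
have /choice[c cP] : forall p : nat * nat * W, exists c, p.2 < nu -> club z c /\
    forall b, c b -> forall g, least (C' (D p.1.1) p.1.2 p.2 z `\` upto b) g ->
      ~ (D p.1.1.+1 `&` E) g.
  move=> [[n k] j] /=; have [jnu|_] := boolP (j < nu); last by exists set0.
  by have [_ _ /(_ k j jnu z Ez)[c cc cP]] := GP _ (cD n); exists c.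
pose c' := [set x | x < z /\ forall n : nat, setT n ->
  [set x | x < z /\ forall k : nat, setT k ->
  [set x | x < z /\ forall j, below nu j -> c (n, k, j) x] x] x].
have cc' : club z c'.
  apply: (club_bigcap wo inf_nu bz (card_nat_le inf_nu)) => n _.
  apply: (club_bigcap wo inf_nu bz (card_nat_le inf_nu)) => k _.
  apply: (club_bigcap wo inf_nu bz (card_lexx _)) => j jnu.
  by have [] := cP (n, k, j) jnu.
(* Meeting [C z] as well makes [b] and [g] the two ends of a gap of the ladder, as [insert_least]
   requires. *)
have [b [[bz' [w [g [bg [wk Dw] Ew /andP[bw wg]]]]] [Cb c'b]]] :=
  stat_z _ (clubI wo inf_nu bz cC cc').
have [Cg _ _] := least_above bg.
have gk : g < kap.
  by have /(clubP wo)[/(_ _ Cg) gz _ _] := cC; apply: lt_trans gz _; case: Ez.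
have Dnw n : D n w by exact: Dw.
have [k [j [v [N [jnu Ev wv vg desc]]]]] := ex_descent psiP qP cD decD Dnw Ew gk (ltW wg).
(* The candidate is built from [D N] but must guess [D N.+1]; stability gives the same [v] for
   both. *)
have [descN _] := desc N (leqnn _); have [_ DSv] := desc N.+1 (leqnSn _).
have vg' : v < g.
  by rewrite lt_neqAle vg andbT; apply/eqP => e; apply: (nEC _ Cg); rewrite -e.
have [_ nguess_v] := cP (N, k, j) jnu.
apply: (nguess_v b _ v); last by split.
  by have [_ /(_ N I)[_ /(_ k I)[_ /(_ j jnu)]]] := c'b.
rewrite -descN; apply: insert_least => //.
by rewrite descN (lt_le_trans bw wv) vg'.
Qed.

End Conclusion.

Theorem theoremA (d : Order.disp_t) (W : orderTopologicalType d) (wo : is_wo W)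
    (nu lam kap : W) (nu_inf : infinite_cardinal nu)
    (lamE : successor_cardinal nu lam) (kapE : successor_cardinal lam kap) :
  exists C : W -> set W,
    [/\ C_sequence (cof_set kap lam) C,
        bounded_seq lam (cof_set kap lam) C &
        forall D : set W, club kap D ->
          exists2 delta : W, cof_set kap lam delta &
            stationary delta
              [set beta | beta < delta /\
                 exists2 gamma : W, least (C delta `\` upto beta) gamma &
                   (D `&` cof_set kap lam) gamma]].
Proof. exact: (club_guessing wo nu_inf lamE kapE). Qed.
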